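(* Let $R$ be a ring. Then the following conditions are equivalent: (1) One has $\mathbb{M}[\mathcal{S}]=\mathrm{Spec}(R)$ for each Serre subcategory $\mathcal{S}$ of $R\text{-}\mathrm{Mod}$; (2) $R$ has dimension $0$.
   Context: All rings are commutative noetherian and all modules are unitary. $R\text{-}\mathrm{Mod}$ is the category of all $R$-modules; subcategories are full and closed under isomorphisms. A Serre subcategory of $R\text{-}\mathrm{Mod}$ is a subcategory closed under taking submodules, quotient modules and extensions. For an ideal $I$ of $R$ and an $R$-module $M$, $\Gamma_I(M)=\{x\in M \mid I^n x=0 \text{ for some } n\geq 1\}$ and $(0:_M I)=\{x\in M\mid Ix=0\}$. A Serre subcategory $\mathcal{S}$ satisfies the Melkersson condition $(C_I)$ if: for every $R$-module $M$, if $\Gamma_I(M)=M$ and $(0:_M I)\in\mathcal{S}$, then $M\in\mathcal{S}$. Put $\mathbb{M}[\mathcal{S}]=\{\mathfrak{p}\in\mathrm{Spec}(R)\mid \mathcal{S}\text{ satisfies }(C_{\mathfrak{p}})\}$. The dimension of $R$ is its Krull dimension. *)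

(* Defs.v *)
From HB Require Import structures.
From mathcomp Require Import all_boot all_algebra ring_quotient.
From mathcomp Require Import boolp classical_sets.

Set Implicit Arguments.
Unset Strict Implicit.
Unset Printing Implicit Defensive.

Import GRing.Theory.

Local Open Scope classical_set_scope.
Local Open Scope ring_scope.

Section Ideals.
Variable R : comNzRingType.

Definition ideal_span (X : set R) : set R :=
  [set a | exists2 s : seq (R * R), (forall cx, cx \in s -> X cx.2)
                                  & a = \sum_(cx <- s) cx.1 * cx.2].

(* The unit ideal is allowed here, unlike in the library's [idealr_closed],
   which describes proper ideals only. *)
Definition is_ideal (I : {pred R}) : Prop :=
  GRing.submod_closed (I : {pred R^o}).

Definition noetherian : Prop :=
  forall I : {pred R}, is_ideal I ->
    exists s : seq R, [set` I] = ideal_span [set` s].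

Definition ideal_exp (I : {pred R}) (n : nat) : set R :=
  ideal_span [set a | exists2 t : n.-tuple R, all (mem I) t
                                            & a = \prod_(b <- t) b].

(* Ideals are boolean predicates; with the classical axioms of [boolp] these
   are arbitrary subsets, and extensionally equal ones are equal. *)
Definition Spec : set {pred R} :=
  [set p | idealr_closed p /\ prime_idealr_closed p].

(* p_0 < p_1 < ... < p_n, a chain of length n *)
Definition prime_chain (n : nat) (p : 'I_n.+1 -> {pred R}) : Prop :=
  (forall i, Spec (p i)) /\
  (forall i j : 'I_n.+1, (i < j)%N -> [set` p i] `<` [set` p j]).

(* [krull_dim d]: the supremum of the lengths of chains of primes is finite and
   equal to d. *)
Definition krull_dim (d : nat) : Prop :=
  (exists p : 'I_d.+1 -> {pred R}, prime_chain p) /\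
  (forall n (p : 'I_n.+1 -> {pred R}), prime_chain p -> (n <= d)%N).

End Ideals.

Arguments noetherian : clear implicits.
Arguments Spec : clear implicits.
Arguments krull_dim : clear implicits.

Section Torsion.
Variables (R : comNzRingType) (I : {pred R}) (M : lmodType R).

Definition Gamma : set M :=
  [set x | exists2 n, (1 <= n)%N & forall a, ideal_exp I n a -> a *: x = 0].

Definition colon_pred : {pred M} :=
  fun x => `[< forall a, a \in I -> a *: x = 0 >].

Lemma colon_submod_closed : GRing.submod_closed colon_pred.
Proof.
split=> [|c x y /asboolP Ix /asboolP Iy]; apply/asboolP => a Ia.
  by rewrite scaler0.
by rewrite scalerDr scalerA mulrC -scalerA Ix // Iy // scaler0 addr0.
Qed.

HB.instance Definition _ :=
  GRing.isSubmodClosed.Build R M colon_pred colon_submod_closed.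

(* The submodule (0 :_M I), as a module in its own right *)
Record colon : Type := Colon {
  colon_val :> M;
  colon_valP : colon_val \in colon_pred
}.

HB.instance Definition _ := [isSub for colon_val].
HB.instance Definition _ := [Choice of colon by <:].
HB.instance Definition _ := [SubChoice_isSubLmodule of colon by <:].

End Torsion.

Arguments Gamma {R} I M.

(* A full subcategory is given by its class of objects. Submodules and quotients
   are taken up to isomorphism, through injective and surjective linear maps, so
   [serre_sub] includes closure under isomorphism. *)
Record serre (R : comNzRingType) (S : lmodType R -> Prop) : Prop := Serre {
  serre_sub : forall (L M : lmodType R) (f : {linear L -> M}),
    injective f -> S M -> S L;
  serre_quot : forall (M N : lmodType R) (g : {linear M -> N}),
    range g = setT -> S M -> S N;
  serre_ext : forall (L M N : lmodType R)
      (f : {linear L -> M}) (g : {linear M -> N}),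
    injective f -> range f = [set x | g x = 0] -> range g = setT ->
    S L -> S N -> S M
}.

Definition melkersson (R : comNzRingType) (S : lmodType R -> Prop)
    (I : {pred R}) : Prop :=
  forall M : lmodType R, Gamma I M = setT -> S (colon I M) -> S M.

Definition MM (R : comNzRingType) (S : lmodType R -> Prop) : set {pred R} :=
  [set p | Spec R p /\ melkersson S p].

(* Main.v *)
(* If R has dimension 0 and M is p-torsion, then p is maximal and its image in
   R_p is nil, so each element of p acts nilpotently on M.  For a nilpotent
   endomorphism a of M the exact sequences 0 -> (0 :_M a) -> M -> aM -> 0 show
   that M lies in S as soon as (0 :_M a) does; now use a finite list of
   generators of p.
   Conversely, let p < q be primes and let S be the Serre subcategory of modules
   killed by some power of q.  The direct sum of the R / q^i is q-torsion and its
   q-socle is killed by q, so (C_q) forces q^n = q^(n+1) for some n.  By Nakayama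
   u q^n = 0 for some u outside q, whence q is contained in p. *)
Require Import Defs.
From HB Require Import structures.
From mathcomp Require Import all_boot all_algebra generic_quotient ring_quotient.
From mathcomp Require Import boolp classical_sets.

Set Implicit Arguments.
Unset Strict Implicit.
Unset Printing Implicit Defensive.

Import GRing.Theory.

Local Open Scope classical_set_scope.
Local Open Scope ring_scope.

(** * Ideals and their powers, Nakayama's lemma, existence of primes *)

Section IdealSpan.
Variable R : comNzRingType.
Implicit Types (X J : set R) (I : {pred R}).

(** Spans and powers of ideals are of type [set R], whereas [is_ideal] takes a boolean predicate;
    this form covers both. *)
Definition ideal_set J : Prop := J 0 /\ forall a u v, J u -> J v -> J (a * u + v).

Lemma ideal_setD J u v : ideal_set J -> J u -> J v -> J (u + v).
Proof. by move=> [_ JD] Ju Jv; rewrite -[u]mul1r; apply: JD. Qed.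

Lemma ideal_setM J a u : ideal_set J -> J u -> J (a * u).
Proof. by move=> [J0 JD] Ju; rewrite -[_ * _]addr0; apply: JD. Qed.

Lemma ideal_set_pred I : is_ideal I <-> ideal_set [set` I].
Proof. by split=> -[I0 ID]; split=> // a u v; apply: ID. Qed.

Lemma ideal_span_ideal X : ideal_set (ideal_span X).
Proof.
split=> [|a _ _ [s sX ->] [t tX ->]]; first by exists [::]; rewrite ?big_nil.
exists ([seq (a * cx.1, cx.2) | cx <- s] ++ t) => [cx|].
  by rewrite mem_cat => /orP[/mapP[dx /sX dxX ->]|/tX].
rewrite big_cat big_map big_distrr /=; congr (_ + _).
by apply: eq_bigr => cx _; rewrite mulrA.
Qed.

Lemma sub_ideal_span X : X `<=` ideal_span X.
Proof.
move=> x Xx; exists [:: (1, x)]; last by rewrite big_seq1 mul1r.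
by move=> cx; rewrite inE => /eqP ->.
Qed.

Lemma ideal_span_min X J : ideal_set J -> X `<=` J -> ideal_span X `<=` J.
Proof.
move=> hJ XJ _ [s sX ->]; rewrite big_seq; apply: (big_ind J) => [|u v|cx /sX /XJ].
- by case: hJ.
- exact: ideal_setD.
- exact: ideal_setM.
Qed.

Lemma ideal_exp1 I : is_ideal I -> ideal_exp I 1 `<=` [set` I].
Proof.
move=> /ideal_set_pred hI; apply: ideal_span_min => // a [[[|b []] //= _]].
by rewrite andbT big_seq1 => Ib ->.
Qed.

(** A product of m + n elements of I is cut into its first m and its last n factors. *)
Lemma ideal_expD I m n :
  ideal_exp I (m + n) `<=`
    ideal_span [set b * c | b in ideal_exp I m & c in ideal_exp I n].
Proof.
apply: ideal_span_min; first exact: ideal_span_ideal.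
move=> _ [t /allP tI ->]; apply: sub_ideal_span.
have szm : size (take m t) == m by rewrite size_takel ?size_tuple ?leq_addr.
have szn : size (drop m t) == n by rewrite size_drop size_tuple addKn.
exists (\prod_(b <- take m t) b).
  by apply: sub_ideal_span; exists (Tuple szm) => //; apply/allP => x /mem_take/tI.
exists (\prod_(b <- drop m t) b); last by rewrite -big_cat cat_take_drop.
by apply: sub_ideal_span; exists (Tuple szn) => //; apply/allP => x /mem_drop/tI.
Qed.

Lemma ideal_exp_le I m n : (m <= n)%N -> ideal_exp I n `<=` ideal_exp I m.
Proof.
move=> /subnK <-; apply: subset_trans (@ideal_expD _ _ _) _.
apply: ideal_span_min => [|_ [b _ [c Ic <-]]]; first exact: ideal_span_ideal.
exact: ideal_setM (ideal_span_ideal _) Ic.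
Qed.

Lemma expr_ideal_exp I b n : b \in I -> ideal_exp I n (b ^+ n).
Proof.
move=> Ib; apply: sub_ideal_span; exists (nseq_tuple n b).
  by apply/allP => x /nseqP[-> _].
by rewrite big_nseq -Monoid.iteropE.
Qed.

Lemma ann_ideal_set (M : lmodType R) (x : M) : ideal_set [set a | a *: x = 0].
Proof.
split=> [|a u v /= ux vx]; first exact: scale0r.
by rewrite scalerDl -scalerA ux vx scaler0 addr0.
Qed.

Lemma Spec_ideal (p : {pred R}) : Spec R p -> is_ideal p.
Proof. by case=> -[p0 _ pD] _; split. Qed.

Lemma Spec_notinM (p : {pred R}) a b :
  Spec R p -> a \notin p -> b \notin p -> a * b \notin p.
Proof.
by move=> [_ pM] pa pb; apply/negP => /pM; rewrite (negPf pa) (negPf pb).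
Qed.

Lemma Spec_exp (p : {pred R}) a n : Spec R p -> a ^+ n \in p -> a \in p.
Proof.
move=> hp; apply: contraLR => pa; elim: n => [|n IHn]; first by case: hp => -[].
by rewrite exprS Spec_notinM.
Qed.

(** Nakayama over the local ring at q with denominators cleared: u stands for a unit there. Instead
    of a determinant, the proof eliminates one generator at a time: u * g = c * g modulo q times the
    span of s, with c in q, and u - c is again outside q. *)
Lemma nakayama (q : {pred R}) (s : seq R) (u : R) :
    Spec R q -> u \notin q ->
    (forall h, h \in s ->
       ideal_span [set c * x | c in [set` q] & x in [set` s]] (u * h)) ->
  exists2 v, v \notin q & forall h, h \in s -> v * h = 0.
Proof.
move=> hq; have [q0 qD] := Spec_ideal hq.
have iq := (ideal_set_pred q).1 (conj q0 qD).
elim: s u => [|g s IHs] u uq hu; first by exists u.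
pose T := ideal_span [set c * x | c in [set` q] & x in [set` s]].
have iT : ideal_set T by exact: ideal_span_ideal.
have split x : ideal_span [set c * y | c in [set` q] & y in [set` g :: s]] x ->
    exists2 c, c \in q & T (x - c * g).
  move: x; apply: ideal_span_min => [|_ [c qc [y + <-]]].
    split=> [|a x y [c qc Tc] [d qd Td]].
      by exists 0; rewrite // mul0r subr0; case: iT.
    exists (a * c + d); first exact: qD.
    rewrite mulrDl opprD addrACA -mulrA -mulrBr.
    exact: iT.2.
  rewrite /= inE => /orP[/eqP ->|sy].
    by exists c; rewrite // subrr; case: iT.
  exists 0; rewrite // mul0r subr0; apply: sub_ideal_span.
  by exists c => //; exists y.
have [c qc] := split _ (hu _ (mem_head _ _)).
rewrite -mulrBl; set w := u - c => Tw.
have wq : w \notin q.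
  apply: contra uq => qw; rewrite -(subrK c u).
  by apply: (ideal_setD iq).
(* Multiplying the relation for h by w turns its term d * g into d * (w * g), which lies in T, so g
   disappears. *)
have [h sh|v vq hv] := IHs (w * u) (Spec_notinM hq wq uq).
  have [|d qd Td] := split (u * h) _; first by apply: hu; rewrite inE sh orbT.
  rewrite -/T -mulrA -(subrK (d * g) (u * h)) mulrDr addrC mulrCA.
  by apply: (iT.2) => //; apply: ideal_setM.
exists (v * w); first exact: Spec_notinM.
have vT : T `<=` [set a | v * a = 0].
  apply: ideal_span_min => [|_ [d _ [y sy <-]]] /=; last first.
    by rewrite mulrCA hv // mulr0.
  split=> [|a x y /= vx vy]; first exact: mulr0.
  by rewrite mulrDr mulrCA vx vy mulr0 addr0.
move=> h; rewrite inE => /orP[/eqP ->|sh]; first by rewrite -mulrA; apply: vT.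
by rewrite mulrAC hv // mul0r.
Qed.

(** Krull's argument: an ideal maximal among those containing J and disjoint from the multiplicative
    set W is prime. *)
Lemma prime_avoiding (J W : set R) :
    ideal_set J -> W 1 -> (forall a b, W a -> W b -> W (a * b)) ->
    J `&` W = set0 ->
  exists q : {pred R}, [/\ Spec R q, J `<=` [set` q] & [set` q] `&` W = set0].
Proof.
move=> iJ W1 WM JW.
(* The conditions bear on the union of J and A, not on A, so that they also hold for the union of
   the empty chain, where they reduce to those on J. *)
pose P A := ideal_set (J `|` A) /\ (J `|` A) `&` W = set0.
have [F FP Ftot|A [[iA AW] Amax]] := @Zorn_bigcup R P.
  split; last first.
    apply/seteqP; split=> // x [[Jx|[A FA Ax]] Wx].
      by rewrite -JW.
    by have [_ <-] := FP A FA; split=> //; right.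
  have J0 : J 0 by case: iJ.
  split=> [|a u v]; first by left.
  have inP A x y : F A -> (J `|` A) x -> (J `|` A) y ->
      (J `|` \bigcup_(X in F) X) (a * x + y).
    move=> FA Ax Ay; have [[_ AD] _] := FP A FA.
    by have [Jxy|Axy] := AD a _ _ Ax Ay; [left|right; exists A].
  case=> [Ju|[A FA Au]] [Jv|[B FB Bv]].
  - by left; case: iJ => _; apply.
  - by apply: (inP B) => //; [left|right].
  - by apply: (inP A) => //; [right|left].
  - have [AB|BA] := Ftot _ _ FA FB.
      by apply: (inP B) => //; right => //; apply: AB.
    by apply: (inP A) => //; right => //; apply: BA.
pose Q := J `|` A; exists (fun x => `[< Q x >]).
have QE x : (x \in (fun x => `[< Q x >] : bool)) = `[< Q x >] by [].
have QA : A `<=` Q by move=> x; right.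
have [Q0 QD] : ideal_set Q := iA.
have QW x : Q x -> W x -> False by move=> Qx Wx; have: set0 x by rewrite -AW.
(* By maximality, the ideal Q + Ra meets W. *)
have meet a : ~ Q a -> exists r, exists2 y, Q y & W (y + r * a).
  move=> Qa; pose B := [set x | exists r, Q (x - r * a)].
  have JB : J `|` B = B.
    by apply/setUidPr => x Jx; exists 0; rewrite mul0r subr0; left.
  have iB : ideal_set B.
    split=> [|c x y [r Qr] [t Qt]]; first by exists 0; rewrite mul0r subr0.
    exists (c * r + t); rewrite mulrDl opprD addrACA -mulrA -mulrBr.
    exact: QD.
  have AltB : A `<` B.
    split=> [|BA].
      by move=> x Ax; exists 0; rewrite mul0r subr0; apply: QA.
    by apply/Qa/QA/BA; exists 1; rewrite mul1r subrr.
  have := Amax B AltB; rewrite /P JB => /not_andP[//|/eqP/set0P[x [[r Qr] Wx]]].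
  by exists r, (x - r * a) => //; rewrite subrK.
split.
- split; first split; rewrite ?QE.
  + exact/asboolP.
  + by apply/asboolP => Q1; exact: (QW 1).
  + by move=> a u v /asboolP Qu /asboolP Qv; apply/asboolP/QD.
  move=> u v /asboolP Quv; rewrite !QE -asbool_or; apply/asboolP.
  (* If u and v are both outside Q, then x + r * u and y + t * v are in W, and so is their product;
     but that product is in Q, since x, y and u * v are. *)
  apply: contrapT => /not_orP[/meet[r [x Qx Wx]] /meet[t [y Qy Wy]]].
  apply: (QW _ _ (WM _ _ Wx Wy)).
  rewrite mulrDl [x * _]mulrC mulrDr mulrACA.
  by apply: (QD _ _ _ Qx); apply: (QD _ _ _ Qy); apply: ideal_setM Quv.
- by move=> x Jx; apply/asboolP; left.
- by apply/seteqP; split=> // x [/asboolP Qx Wx]; case: (QW x).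
Qed.

End IdealSpan.

(** * Quotient of a module by a submodule *)

Section Quotient.
Variables (R : nzRingType) (M : lmodType R) (K : {pred M}).
Hypothesis K_closed : GRing.submod_closed K.

(* Carries the proof [K_closed], on which the canonical structure is keyed. *)
Definition quot_pred of GRing.submod_closed K : {pred M} := K.
Local Notation K' := (quot_pred K_closed).

HB.instance Definition _ := GRing.isSubmodClosed.Build R M K' K_closed.

Definition quot_lmod : Type := Quotient.quot K'.

HB.instance Definition _ := GRing.Zmodule.on quot_lmod.

Definition quot_pi (x : M) : quot_lmod := \pi_(Quotient.quot K')%qT x.

Lemma quot_pi_eq x y : quot_pi x = quot_pi y <-> x - y \in K.
Proof. by rewrite -[K]/K' Quotient.idealrBE; split=> /eqP. Qed.

Lemma quot_pi_surj (x : quot_lmod) : exists y, x = quot_pi y.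
Proof. by elim/quotP: x => y _; exists y. Qed.

Lemma quot_piD x y : quot_pi (x + y) = quot_pi x + quot_pi y.
Proof. exact: Quotient.pi_add. Qed.

Definition quot_scale a (x : quot_lmod) : quot_lmod := quot_pi (a *: repr x).

Lemma quot_piZ a x : quot_pi (a *: x) = quot_scale a (quot_pi x).
Proof.
apply/quot_pi_eq; rewrite -scalerBr -[K]/K' rpredZ //; apply/quot_pi_eq.
by rewrite /quot_pi reprK.
Qed.

Fact quot_scaleA a b x : quot_scale a (quot_scale b x) = quot_scale (a * b) x.
Proof. by have [y ->] := quot_pi_surj x; rewrite -!quot_piZ scalerA. Qed.

Fact quot_scale1 : left_id 1 quot_scale.
Proof. by move=> x; have [y ->] := quot_pi_surj x; rewrite -quot_piZ scale1r. Qed.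

Fact quot_scaleDr : right_distributive quot_scale +%R.
Proof.
move=> a x y; have [x' ->] := quot_pi_surj x; have [y' ->] := quot_pi_surj y.
by rewrite -quot_piD -!quot_piZ -quot_piD scalerDr.
Qed.

Fact quot_scaleDl x : {morph quot_scale^~ x : a b / a + b}.
Proof.
by move=> a b; have [y ->] := quot_pi_surj x; rewrite -!quot_piZ -quot_piD scalerDl.
Qed.

HB.instance Definition _ := GRing.Zmodule_isLmodule.Build R quot_lmod
  quot_scaleA quot_scale1 quot_scaleDr quot_scaleDl.

Lemma quot_pi_linear : linear quot_pi.
Proof. by move=> a x y; rewrite quot_piD quot_piZ. Qed.

HB.instance Definition _ :=
  GRing.isLinear.Build R M quot_lmod _ quot_pi quot_pi_linear.

Lemma quot_pi0 x : quot_pi x = 0 <-> x \in K.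
Proof. by rewrite -(linear0 quot_pi) quot_pi_eq subr0. Qed.

End Quotient.

(** * The submodule aM and the surjection of M onto it *)

Section Image.
Variables (R : comNzRingType) (M : lmodType R) (a : R).

Definition image_pred : {pred M} := fun x => `[< exists y, x = a *: y >].

Lemma image_submod_closed : GRing.submod_closed image_pred.
Proof.
split=> [|c x y /asboolP[x' ->] /asboolP[y' ->]]; apply/asboolP.
  by exists 0; rewrite scaler0.
by exists (c *: x' + y'); rewrite scalerDr !scalerA mulrC.
Qed.

HB.instance Definition _ :=
  GRing.isSubmodClosed.Build R M image_pred image_submod_closed.

Record image : Type := Image {
  image_val :> M;
  image_valP : image_val \in image_pred
}.

HB.instance Definition _ := [isSub for image_val].
HB.instance Definition _ := [Choice of image by <:].
HB.instance Definition _ := [SubChoice_isSubLmodule of image by <:].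

Definition to_image (x : M) : image :=
  Image (introT (asboolP _) (ex_intro _ x erefl)).

Lemma to_image_linear : linear to_image.
Proof.
by move=> c x y; apply: val_inj; rewrite linearP /= scalerDr !scalerA mulrC.
Qed.

HB.instance Definition _ :=
  GRing.isLinear.Build R M image _ to_image to_image_linear.

Lemma to_image_surj : range to_image = setT.
Proof.
apply/seteqP; split=> // -[x xP] _; have /asboolP[y xE] := xP.
by exists y => //; apply: val_inj; rewrite /= xE.
Qed.

End Image.

(** * Serre subcategories and modules with nilpotent action *)

Section Serre.
Variables (R : comNzRingType) (S : lmodType R -> Prop) (hS : serre S).

Lemma colonP (I : {pred R}) (M : lmodType R) (x : M) :
  reflect (forall a, a \in I -> a *: x = 0) (x \in colon_pred I (M:=M)).
Proof. exact: asboolP. Qed.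

(** Such an f factors through (0 :_M I). This serves to compare annihilator submodules, including
    iterated ones, without constructing isomorphisms. *)
Lemma serre_colon_sub (I : {pred R}) (L M : lmodType R) (f : {linear L -> M}) :
    injective f -> (forall x, f x \in colon_pred I (M:=M)) ->
  S (colon I M) -> S L.
Proof.
move=> f_inj fI SM; pose g x := Colon (fI x).
have g_lin : linear g.
  by move=> c x y; apply: val_inj; rewrite [RHS]linearP /= linearP.
pose G : {linear L -> colon I M} :=
  HB.pack g (GRing.isLinear.Build R _ _ _ g g_lin).
apply: (serre_sub hS (f := G)) SM => x y /(congr1 val).
exact: f_inj.
Qed.

(** Induction on n: aM is killed by a ^+ n, and its a-torsion embeds in that of M. *)
Lemma serre_nilpotent (a : R) n (M : lmodType R) :
  (forall x : M, a ^+ n *: x = 0) -> S (colon (pred1 a) M) -> S M.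
Proof.
elim: n M => [|n IHn] M aM SM.
  (* For exponent 0 the module is zero, hence a quotient of the given object of S. *)
  have M0 (x : M) : x = 0 by rewrite -[x]scale1r -(expr0 a).
  apply: (serre_quot hS (g := val : {linear colon (pred1 a) M -> M})) SM.
  by apply/seteqP; split=> // x _; exists 0; rewrite // [RHS]M0 [LHS]M0.
have SN : S (image M a).
  apply: IHn => [[x xP]|].
    apply: val_inj; rewrite linearZ /=; have /asboolP[y ->] := xP.
    by rewrite scalerA -exprSr.
  apply: (serre_colon_sub
    (f := val \o val : {linear colon (pred1 a) (image M a) -> M})) SM.
    exact: inj_comp val_inj val_inj.
  move=> x; apply/colonP => b ba; have /colonP/(_ b ba) := valP x.
  by move/(congr1 val); rewrite linearZ linear0.
apply: (serre_ext hS (f := val : {linear colon (pred1 a) M -> M})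
   (g := @to_image R M a)) SM SN => //.
- exact: val_inj.
- apply/seteqP; split=> [_ [[x xP] _ <-]|x /(congr1 val) /= ax].
    by apply: val_inj; have /colonP := xP; apply; rewrite inE.
  have xP : x \in colon_pred (pred1 a) (M:=M) by apply/colonP => b /eqP ->.
  by exists (Colon xP).
- exact: to_image_surj.
Qed.

(** One element is peeled off at a time: the part of (0 :_M a) killed by s is the part of M killed
    by a and s. *)
Lemma serre_locally_nilpotent (s : seq R) (M : lmodType R) :
  (forall a, a \in s -> exists n, forall x : M, a ^+ n *: x = 0) ->
  S (colon (mem s) M) -> S M.
Proof.
elim: s M => [|a s IHs] M nilM SM.
  apply: (serre_quot hS (g := val : {linear colon (mem [::]) M -> M})) SM.
  apply/seteqP; split=> // x _.
  have x0 : x \in colon_pred (mem [::]) (M:=M) by apply/colonP.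
  by exists (Colon x0).
have [n aM] := nilM a (mem_head a s).
apply: (serre_nilpotent aM); apply: IHs => [b sb|].
  have [|m bM] := nilM b; first by rewrite inE sb orbT.
  by exists m => x; apply: val_inj; rewrite linearZ; apply: bM.
apply: (serre_colon_sub
  (f := val \o val : {linear colon (mem s) (colon (pred1 a) M) -> M})) SM.
  exact: inj_comp val_inj val_inj.
move=> x; apply/colonP => b; rewrite inE => /orP[ba|sb].
  by have /colonP := valP (val x); apply.
by have /colonP/(_ b sb)/(congr1 val) := valP x; rewrite linearZ linear0.
Qed.

End Serre.

(** * Dimension 0 implies the Melkersson conditions *)

Section DimensionZero.
Variable R : comNzRingType.
Hypothesis dimR : krull_dim R 0.
Implicit Types p q : {pred R}.

Lemma dim0_Spec_max p q :
  Spec R p -> Spec R q -> [set` p] `<=` [set` q] -> [set` q] `<=` [set` p].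
Proof.
move=> hp hq pq; apply: contrapT => nqp.
(* A strict inclusion would be a chain of length 1, exceeding the dimension. *)
pose c (i : 'I_2) := if i == ord0 then p else q.
suff /dimR.2 : prime_chain c by [].
split=> [i|i j ij]; first by rewrite /c; case: ifP.
have -> : i = ord0 by apply: val_inj; case: i j ij => -[|[|]] // ? [[|[|]]].
have -> : j = ord_max by apply: val_inj; case: i j ij => -[|[|]] // ? [[|[|]]].
by split.
Qed.

(** This is maximality of p, as invertibility of s modulo p. The ideal J is p + Rs; were it proper,
    a prime above it would contain p strictly. *)
Lemma dim0_inv p s : Spec R p -> s \notin p -> exists r, 1 - r * s \in p.
Proof.
move=> hp ps; pose J := [set x | exists r, x - r * s \in p].
have [p0 pD] := Spec_ideal hp.
have iJ : ideal_set J.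
  split=> [|a x y [r pr] [t pt]]; first by exists 0; rewrite mul0r subr0.
  exists (a * r + t); rewrite mulrDl opprD addrACA -mulrA -mulrBr.
  exact: pD.
apply: contrapT => J1.
have [|||q [hq Jq _]] := @prime_avoiding R J [set 1] iJ.
- by [].
- by move=> _ _ -> ->; rewrite mulr1.
- by apply/seteqP; split=> // x [Jx x1]; apply: J1; rewrite -x1.
have pJ : [set` p] `<=` J by move=> x px; exists 0; rewrite mul0r subr0.
have qp := dim0_Spec_max hp hq (subset_trans pJ Jq).
move/negP: ps; apply; apply/qp/Jq.
by exists 1; rewrite mul1r subrr.
Qed.

(* The maximal ideal of the localization at p is a nil ideal. *)
Lemma dim0_nil p a : Spec R p -> a \in p ->
  exists2 s, s \notin p & exists n, s * a ^+ n = 0.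
Proof.
move=> hp pa.
(* W is the multiplicative set generated by a and the complement of p. A prime disjoint from W lies
   inside p, hence equals p, yet omits a. *)
pose W := [set x | exists2 s, s \notin p & exists n, x = s * a ^+ n].
have p1 : 1 \notin p by case: hp => -[].
apply: contrapT => nW.
have [||||q [hq _ qW]] := @prime_avoiding R [set 0] W.
- by split=> // b _ _ -> ->; rewrite /= mulr0 addr0.
- by exists 1 => //; exists 0; rewrite mulr1.
- move=> _ _ [s ps [m ->]] [t pt [n ->]].
  by exists (s * t); [exact: Spec_notinM|exists (m + n); rewrite mulrACA exprD].
- apply/seteqP; split=> // x [-> [s ps [n sa]]].
  by apply: nW; exists s => //; exists n.
have {}qW x : x \in q -> W x -> False by move=> qx Wx; have: set0 x by rewrite -qW.
have qp : [set` q] `<=` [set` p].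
  move=> x qx; apply: contrapT => /negP px.
  by apply: (qW x qx); exists x => //; exists 0; rewrite mulr1.
apply: (qW a); first exact: (dim0_Spec_max hq hp qp).
by exists 1 => //; exists 1; rewrite mul1r.
Qed.

Lemma dim0_melkersson (S : lmodType R -> Prop) p :
  noetherian R -> serre S -> Spec R p -> melkersson S p.
Proof.
move=> hR hS hp M GM SM; have [s ps] := hR p (Spec_ideal hp).
have sp a : a \in s -> a \in p.
  by move=> sa; have : [set` p] a by rewrite ps; apply: sub_ideal_span.
apply: (serre_locally_nilpotent hS (s := s)) => [a /sp pa|]; last first.
  apply: (serre_colon_sub hS (f := val : {linear colon (mem s) M -> M})) SM.
    exact: val_inj.
  move=> x; apply/colonP => a pa; have : ideal_span [set` s] a by rewrite -ps.
  move: a {pa}; apply: ideal_span_min; first exact: ann_ideal_set.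
  by move=> a sa; have /colonP := valP x; apply.
have [t pt [n ta]] := dim0_nil hp pa; have [r prt] := dim0_inv hp pt.
(* The exponent n comes from t * a ^+ n = 0 and is the same for all x, while the torsion exponent m
   below depends on x. *)
exists n => x; have : Gamma p M x by rewrite GM.
move=> [m _ /(_ _ (expr_ideal_exp m prt)) bx].
(* [1 - (1 - r * t) ^+ m] is a multiple of [t] that fixes [x]. *)
have := subrX1 (1 - r * t) m; rewrite [_ - 1 in RHS]addrC addKr.
move: (\sum_(i < m) _) => c /(congr1 (fun b => (a ^+ n * b) *: x)).
rewrite mulrBr mulr1 scalerBl -scalerA bx scaler0 sub0r mulNr mulrN scaleNr.
rewrite -mulrA mulrCA [a ^+ n * _]mulrA [a ^+ n * t]mulrC ta mul0r mulr0 scale0r.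
exact: oppr_inj.
Qed.

End DimensionZero.

(** * The Melkersson condition at q makes q a minimal prime *)

Section Unbounded.
Variables (R : comNzRingType) (q : {pred R}).
Hypothesis hq : Spec R q.

Definition bounded (M : lmodType R) : Prop :=
  exists n, forall (x : M) a, ideal_exp q n a -> a *: x = 0.

Lemma bounded_serre : serre bounded.
Proof.
split=> [L M f f_inj [n nM]|M N g g_surj [n nM]|L M N f g f_inj fg _ [n nL] [m mN]].
- by exists n => x a qa; apply: f_inj; rewrite linearZ linear0; apply: nM.
- exists n => x a qa; have [y _ <-] : range g x by rewrite g_surj.
  by rewrite -linearZ; have -> := nM y a qa; rewrite linear0.
- exists (n + m)%N => x a /ideal_expD; move: a.
  apply: ideal_span_min; first exact: ann_ideal_set.
  move=> _ [b qb [c qc <-]] /=; rewrite -scalerA.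
  have [y _ <-] : range f (c *: x) by rewrite fg /= linearZ; apply: mN.
  by rewrite -linearZ; have -> := nL y b qb; rewrite linear0.
Qed.

(** This is the Rees algebra of q, the sum of the q^i X^i, inside R[X]; dividing R[X] by it leaves R
    / q^i in degree i. *)
Definition coef_exp_pred : {pred {poly R}} :=
  fun f => `[< forall i, ideal_exp q i f`_i >].

Lemma coef_exp_closed : GRing.submod_closed coef_exp_pred.
Proof.
split=> [|a f g /asboolP qf /asboolP qg]; apply/asboolP => i.
  by rewrite coef0; apply: (ideal_span_ideal _).1.
rewrite coefD coefZ; exact: (ideal_span_ideal _).2 (qf i) (qg i).
Qed.

(* The direct sum of the modules R / q^i. *)
Definition exp_sum := quot_lmod coef_exp_closed.

Lemma melkersson_exp_stable :
  melkersson bounded q -> exists n, ideal_exp q n `<=` ideal_exp q n.+1.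
Proof.
have piP f : quot_pi coef_exp_closed f = 0 <-> forall i, ideal_exp q i f`_i.
  by rewrite quot_pi0; split=> /asboolP.
move=> /(_ exp_sum) [||n nM].
- apply/seteqP; split=> // x _; have [f ->] := quot_pi_surj x.
  (* The power of q must lie in q^i for all i below [size f]; the successor also ensures that the
     exponent is positive. *)
  exists (size f).+1 => // a qa; rewrite -linearZ; apply/piP => i.
  rewrite coefZ; have [fi|fi] := leqP (size f) i.
    by rewrite nth_default // mulr0; apply: (ideal_span_ideal _).1.
  rewrite mulrC; apply: ideal_setM; first exact: ideal_span_ideal.
  by apply: ideal_exp_le qa; rewrite ltnW // ltnW.
- exists 1%N => x a qa; apply: val_inj; rewrite linearZ linear0.
  have /colonP := valP x; apply.
  exact: (ideal_exp1 (Spec_ideal hq)).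
(* The class of X^(n+1) generates the summand R / q^(n+1), so killing it means lying in q^(n+1). *)
exists n => a /(nM (quot_pi coef_exp_closed 'X^(n.+1))).
by rewrite -linearZ => /piP/(_ n.+1); rewrite coefZ coefXn eqxx mulr1.
Qed.

Lemma exp_stable_Spec_min n p :
    noetherian R -> ideal_exp q n `<=` ideal_exp q n.+1 ->
  Spec R p -> [set` p] `<=` [set` q] -> [set` q] `<=` [set` p].
Proof.
move=> hR qn hp pq b qb.
have [s qs] : exists s : seq R, ideal_exp q n = ideal_span [set` s].
  (* [noetherian] speaks of boolean predicates, so the power is recast as one. *)
  have -> : ideal_exp q n = [set` (fun x => `[< ideal_exp q n x >]) : {pred R}].
    by apply/seteqP; split=> x /asboolP.
  apply: hR; split=> [|a u v /asboolP qu /asboolP qv]; apply/asboolP.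
    exact: (ideal_span_ideal _).1.
  exact: (ideal_span_ideal _).2.
have [|h sh|v vq vs] := @nakayama R q s 1 hq.
- by case: hq => -[].
(* The hypothesis of Nakayama with u = 1: q^n is contained in q^(n+1), hence in q times the span of
   s. *)
- rewrite mul1r; have /qn : ideal_exp q n h by rewrite qs; apply: sub_ideal_span.
  rewrite -add1n => /ideal_expD; move: {sh} h.
  apply: ideal_span_min; first exact: ideal_span_ideal.
  move=> _ [c qc [d + <-]]; rewrite qs => {}qd.
  have {}qc := ideal_exp1 (Spec_ideal hq) qc.
  move: d qd; apply: ideal_span_min => [|d sd].
    split=> [|a x y /= qx qy]; first by rewrite mulr0; apply: (ideal_span_ideal _).1.
    by rewrite mulrDr mulrCA; apply: (ideal_span_ideal _).2.
  by apply: sub_ideal_span; exists c => //; exists d.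
have vb : v * b ^+ n = 0.
  have : ideal_span [set` s] (b ^+ n) by rewrite -qs; apply: expr_ideal_exp.
  move: (b ^+ n); apply: ideal_span_min => //.
  split=> [|a x y /= vx vy]; first exact: mulr0.
  by rewrite mulrDr mulrCA vx vy mulr0 addr0.
(* Since p is contained in q, v is outside p; as v * b ^+ n = 0 is in p, so is b ^+ n. *)
apply: (Spec_exp (n := n) hp); apply: contrapT => /negP pb.
have /negP[] : v * b ^+ n \notin p.
  by apply: Spec_notinM => //; apply: contra vq => /pq.
by rewrite vb; case: (Spec_ideal hp).
Qed.

End Unbounded.

Theorem theorem5p1 (R : comNzRingType) (hR : noetherian R) :
  (forall S : lmodType R -> Prop, serre S -> MM S = Spec R) <-> krull_dim R 0.
Proof.
split=> [MS|dimR S hS]; last first.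
  by apply/seteqP; split=> p [hp] // pM; split=> //; apply: dim0_melkersson.
split.
  (* As 1 is nonzero, some prime exists; it is a chain of length 0. *)
  have [||||p [hp _ _]] := @prime_avoiding R [set 0] [set 1].
  - by split=> // a _ _ -> ->; rewrite /= mulr0 addr0.
  - by [].
  - by move=> _ _ -> ->; rewrite mulr1.
  - by apply/seteqP; split=> // x [-> /eqP]; rewrite eq_sym oner_eq0.
  by exists (fun=> p); split=> // i j; rewrite !ord1.
move=> [//|n] p [hp pS].
(* In a chain of positive length the last prime strictly contains the first, but the condition at
   the last prime makes it minimal. *)
have [_ []] := pS ord0 ord_max isT.
have [_ /melkersson_exp_stable[//|m qm]] : MM (bounded (p ord_max)) (p ord_max).
  by rewrite MS //; apply: bounded_serre.
by apply: (exp_stable_Spec_min _ hR qm) => //; case: (pS ord0 ord_max isT).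
Qed.
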